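(* There is a function $C=C(K,L,D,\tau,\delta)$, defined for $K\ge0$, $L>0$, $D\ge0$, $\tau>0$, $\delta\ge0$, satisfying $C(K,L,D,\tau,\delta)=O_{K,L,D,\tau}(\delta^{1/4})$ as $\delta\to0$ (that is, for each fixed $K,L,D,\tau$ there are constants $A,\delta_0>0$ with $|C(K,L,D,\tau,\delta)|\le A\,\delta^{1/4}$ for all $0\le\delta\le\delta_0$), such that the following holds. Let $\delta\ge0$, let $(X,d)$ be a proper $\delta$-hyperbolic geodesic space, and let $f:X\to\mathbb{R}$ be a $K$-convex $L$-Lipschitz function with $K\ge0$ and $L>0$ such that $\inf_X f$ is attained at some $p\in X$. Take any $x_1,x_2\in X$, any $\tau>0$, and any $y_i\in\mathsf{J}^f_\tau(x_i)$ for $i=1,2$, and assume $d(p,y_1)\le d(p,y_2)$. (i) If $d(p,y_1)\ge(x_1|x_2)_p$, then \[ d(y_1,y_2)\le d(x_1,x_2)-d(x_1,y_1)-d(x_2,y_2)+\frac{20\sqrt{2\tau L\delta}}{\sqrt{K\tau+1}}+24\delta. \] In the case $K>0$ and $\tau>K^{-1}$, we further have \[ d(y_1,y_2)\le d(x_1,x_2)-\left(1-\frac1{K\tau}\right)\frac{f(x_1)+f(x_2)-2f(p)}{L}+\frac{20\sqrt{2\tau L\delta}}{\sqrt{K\tau+1}}+24\delta. \] (ii) If $d(p,y_1)<(x_1|x_2)_p$, then \[ d(y_1,y_2)\le d(x_1,x_2)-(p|x_2)_{x_1}+C(K,L,D,\tau,\delta), \] where $D:=\max\{d(p,x_1),d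(p,x_2)\}$.
   Context: Let $(X,d)$ be a metric space. Proper: every bounded closed subset of $X$ is compact. Geodesic space: any two points $x,y\in X$ are joined by a (minimal) geodesic, i.e. a map $\gamma:[0,\ell]\to X$ with $\gamma(0)=x$, $\gamma(\ell)=y$ and $d(\gamma(s),\gamma(t))=(|s-t|/\ell)\,d(x,y)$ for all $s,t\in[0,\ell]$. Gromov product: $(x|y)_p:=\frac12\{d(p,x)+d(p,y)-d(x,y)\}$ for $p,x,y\in X$. The space $(X,d)$ is $\delta$-hyperbolic ($\delta\ge0$) if $(x|z)_p\ge\min\{(x|y)_p,(y|z)_p\}-\delta$ for all $p,x,y,z\in X$. $L$-Lipschitz: $|f(x)-f(y)|\le L\,d(x,y)$ for all $x,y\in X$. $K$-convex (in the weak geodesic sense): for any $x,y\in X$ there is some geodesic $\gamma:[0,1]\to X$ from $x$ to $y$ such that $f(\gamma(t))\le(1-t)f(x)+tf(y)-\frac K2(1-t)t\,d^2(x,y)$ for all $t\in[0,1]$. Proximal (resolvent) operator: for $\tau>0$ and $x\in X$, $\mathsf{J}^f_\tau(x)$ is the set of all minimizers over $y\in X$ of $y\mapsto f(y)+\frac{d^2(x,y)}{2\tau}$. *)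

(* Defs.v *)
From HB Require Import structures.
From mathcomp Require Import all_boot all_order all_algebra.
From mathcomp Require Import all_classical all_reals all_analysis.

Set Implicit Arguments.
Unset Strict Implicit.
Unset Printing Implicit Defensive.

Import Order.TTheory GRing.Theory Num.Theory.

Local Open Scope classical_set_scope.
Local Open Scope ring_scope.

(* The library's [bounded_set] is only available in normed modules. *)
Definition metric_bounded (R : realType) (X : metricType R) (A : set X) : Prop :=
  exists M : R, forall x y, A x -> A y -> mdist x y <= M.

Definition proper_space (R : realType) (X : metricType R) : Prop :=
  forall A : set X, metric_bounded A -> closed A -> compact A.

(* Only the values of [g] on [0, l] matter.  Geodesics are minimal, have
   constant speed, and may be constant (when [x = y]). *)
Definition is_geodesic (R : realType) (X : metricType R)
    (l : R) (g : R -> X) (x y : X) : Prop :=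
  [/\ 0 < l, g 0 = x, g l = y &
      forall s t : R, 0 <= s <= l -> 0 <= t <= l ->
        mdist (g s) (g t) = `|s - t| / l * mdist x y].

Definition geodesic_space (R : realType) (X : metricType R) : Prop :=
  forall x y : X, exists l : R, exists g : R -> X, is_geodesic l g x y.

(* [gromov p x y] is (x|y)_p: the base point comes first. *)
Definition gromov (R : realType) (X : metricType R) (p x y : X) : R :=
  2^-1 * (mdist p x + mdist p y - mdist x y).

Definition hyperbolic (R : realType) (delta : R) (X : metricType R) : Prop :=
  forall p x y z : X,
    Num.min (gromov p x y) (gromov p y z) - delta <= gromov p x z.

(* The library's [k.-lipschitz] is only available between normed modules. *)
Definition metric_lipschitz (R : realType) (X : metricType R)
    (L : R) (f : X -> R) : Prop :=
  forall x y : X, `|f x - f y| <= L * mdist x y.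

(* The inequality is only required along some geodesic from x to y. *)
Definition weakly_convex (R : realType) (X : metricType R)
    (K : R) (f : X -> R) : Prop :=
  forall x y : X, exists2 g : R -> X, is_geodesic 1 g x y &
    forall t : R, 0 <= t <= 1 ->
      f (g t) <= (1 - t) * f x + t * f y
                 - K / 2 * (1 - t) * t * mdist x y ^+ 2.

Definition minimizers (R : realType) (X : metricType R) (f : X -> R) : set X :=
  [set y | forall z : X, f y <= f z].

Definition resolvent (R : realType) (X : metricType R)
    (f : X -> R) (tau : R) (x : X) : set X :=
  minimizers (fun y : X => f y + mdist x y ^+ 2 / (2 * tau)).

(* Main.v *)
(** A resolvent point y of x almost lies on a geodesic from p to x: f does not
  increase along the convex geodesic from y to its minimizer p, so the point z
  at distance (x|p)_y from y on it satisfies d(x,y) <= d(x,z), whereas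
  hyperbolicity brings z closer to x by about (x|p)_y; this forces
  (x|p)_y <= 2 delta.  Part (i) is then the four-point inequality.  Its second
  form comes from comparing y with the point at parameter 1/(K tau + 1) on the
  geodesic to p.

  For part (ii), if y2 is not close enough to y1 already, then y2 is in the
  direction of x1 when seen from y1.  Moving y1 and y2 by s towards each other
  along a convex geodesic does not increase the sum of the values of f, so the
  sum of the squared distances to x1 and x2 cannot decrease.  Since the first
  point gets closer to x1 by about s, d(x1,y1) exceeds d(x2,y2) by at most
  O(s + delta/s), and s = sqrt delta gives an error O(delta^(1/2)), which is
  stronger than required. *)
Require Import Defs.
From HB Require Import structures.
From mathcomp Require Import all_boot all_order all_algebra.
From mathcomp Require Import all_classical all_reals all_analysis.
From mathcomp Require Import ring lra.

Set Implicit Arguments.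
Unset Strict Implicit.
Unset Printing Implicit Defensive.

Import Order.TTheory GRing.Theory Num.Theory.

Local Open Scope classical_set_scope.
Local Open Scope ring_scope.

Section HyperbolicMetric.
Variables (R : realType) (X : metricType R).
Implicit Types (p q x y z : X) (f : X -> R).

(** * Gromov products and geodesics *)

Lemma gromov_le_mdist p x y : gromov p x y <= mdist p x.
Proof. by rewrite /gromov; have := metric_triangle p x y; lra. Qed.

Lemma gromovC p x y : gromov p x y = gromov p y x.
Proof. by rewrite /gromov (metric_sym x y); lra. Qed.

Lemma gromov_ge0 p x y : 0 <= gromov p x y.
Proof.
by rewrite /gromov; have := metric_triangle x p y; rewrite (metric_sym x p); lra.
Qed.

Lemma hyperbolic_le (delta m : R) p x y z : hyperbolic delta X ->
  m <= gromov p x y -> m <= gromov p y z -> m - delta <= gromov p x z.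
Proof.
move=> hyp mxy myz; apply: le_trans (hyp p x y z).
by rewrite lerB // le_min mxy myz.
Qed.

Lemma geodesic_mdist (g : R -> X) x y (t : R) :
  is_geodesic 1 g x y -> 0 <= t <= 1 ->
  mdist x (g t) = t * mdist x y /\ mdist (g t) y = (1 - t) * mdist x y.
Proof.
move=> [_ g0 g1 gd] t01.
have [h0 h1] : 0 <= (0 : R) <= 1 /\ 0 <= (1 : R) <= 1 by split; lra.
split.
  by rewrite -[in LHS]g0 gd // divr1 sub0r normrN ger0_norm //; lra.
by rewrite -[in LHS]g1 gd // divr1 distrC ger0_norm //; lra.
Qed.

(** Since [z] lies between [y] and [q], [gromov y q z] equals [mdist y z]; the four-point inequality
    based at [y] then bounds [gromov y x z] from below. *)
Lemma hyperbolic_mdist_le (delta : R) x y z q : hyperbolic delta X ->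
  mdist y z + mdist z q = mdist y q -> mdist y z <= gromov y x q ->
  mdist x z <= mdist x y - mdist y z + 2 * delta.
Proof.
move=> hyp yzq yzG.
have yzE : mdist y z <= gromov y q z by rewrite /gromov (metric_sym q z); lra.
by have := hyperbolic_le hyp yzG yzE; rewrite /gromov (metric_sym y x); lra.
Qed.

(** * A single resolvent point *)

Lemma resolvent_sqr_le f (tau : R) x y z : 0 < tau -> resolvent f tau x y ->
  mdist x y ^+ 2 <= mdist x z ^+ 2 + 2 * tau * (f z - f y).
Proof.
move=> tau0 /(_ z) h.
have t2 : 0 < 2 * tau by lra.
rewrite -subr_ge0 in h; have := mulr_ge0 (ltW t2) h.
have e (a : R) : 2 * tau * (a / (2 * tau)) = a by rewrite mulrC divfK// lt0r_neq0.
by rewrite mulrBr !mulrDr !e; lra.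
Qed.

Lemma convex_geodesic_le (K : R) f x y : 0 <= K -> weakly_convex K f ->
  exists2 g : R -> X, is_geodesic 1 g x y &
    forall t, 0 <= t <= 1 -> f (g t) <= (1 - t) * f x + t * f y.
Proof.
move=> K0 /(_ x y)[g gg gf]; exists g => // t t01.
apply: le_trans (gf t t01) _; rewrite gerBl.
case/andP: t01 => t0 t1.
by rewrite !mulr_ge0 ?mdist_ge0 ?invr_ge0 ?subr_ge0.
Qed.

Lemma resolvent_gromov_le (delta K tau : R) f p x y :
  0 <= delta -> hyperbolic delta X -> 0 <= K -> weakly_convex K f ->
  minimizers f p -> 0 < tau -> resolvent f tau x y ->
  gromov y x p <= 2 * delta.
Proof.
move=> d0 hyp K0 fK fp tau0 yx.
have [g gg gf] := convex_geodesic_le y p K0 fK.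
have G0 := gromov_ge0 y x p.
have Ga : gromov y x p <= mdist y p by rewrite gromovC; exact: gromov_le_mdist.
have Gb : gromov y x p <= mdist x y by rewrite (metric_sym x y) gromov_le_mdist.
have [a0|a0] := lerP (mdist y p) 0; first lra.
set t := gromov y x p / mdist y p.
have ta : t * mdist y p = gromov y x p by rewrite divfK // gt_eqF.
have t01 : 0 <= t <= 1 by rewrite divr_ge0 ?(ltW a0) //= ler_pdivrMr // mul1r.
have [yz zp] := geodesic_mdist gg t01; rewrite ta in yz.
have := @hyperbolic_mdist_le delta x y (g t) p hyp.
rewrite yz zp => /(_ _ (lexx _)) xz.
have {}xz := xz ltac:(lra).
have fz : f (g t) <= f y.
  by apply: le_trans (gf t t01) _; have := fp y => /= pz; nra.
have r := resolvent_sqr_le (g t) tau0 yx.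
have z0 := mdist_ge0 x (g t).
(* Otherwise [g t] would be strictly closer to [x] than [y] is, without a larger value of [f]. *)
rewrite leNgt; apply/negP => Gd.
have xz2 : mdist x (g t) ^+ 2 <= (mdist x y - (gromov y x p - 2 * delta)) ^+ 2.
  by rewrite ler_sqr ?nnegrE //; lra.
have : 2 * tau * (f (g t) - f y) <= 0 by rewrite pmulr_rle0; lra.
by nra.
Qed.

Lemma resolvent_almost_geodesic (delta K tau : R) f p x y :
  0 <= delta -> hyperbolic delta X -> 0 <= K -> weakly_convex K f ->
  minimizers f p -> 0 < tau -> resolvent f tau x y ->
  mdist p y + mdist x y <= mdist p x + 4 * delta.
Proof.
move=> d0 hyp K0 fK fp tau0 yx.
have := resolvent_gromov_le d0 hyp K0 fK fp tau0 yx.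
by rewrite /gromov (metric_sym y x) (metric_sym y p) (metric_sym x p); lra.
Qed.

Lemma resolvent_value_le (K tau : R) f p x y :
  0 < K -> weakly_convex K f -> minimizers f p -> K^-1 < tau ->
  resolvent f tau x y -> f y - f p <= (f x - f p) / (K * tau).
Proof.
move=> K0 fK fp tauK yx.
have Ki : 0 < K^-1 by rewrite invr_gt0.
have tau0 : 0 < tau by lra.
have Kt : 1 < K * tau by rewrite -(mulfV (lt0r_neq0 K0)) ltr_pM2l.
have [g gg gf] := fK y p.
set t := (K * tau + 1)^-1.
have tE : t * (K * tau + 1) = 1 by rewrite mulVf // gt_eqF //; lra.
have t0 : 0 < t by rewrite invr_gt0; lra.
have t1 : t <= 1 by nra.
have t01 : 0 <= t <= 1 by lra.
have [yz _] := geodesic_mdist gg t01.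
have := gf t t01 => fz.
have xz := metric_triangle x y (g t); rewrite yz in xz.
have rz := resolvent_sqr_le (g t) tau0 yx.
have := resolvent_sqr_le x tau0 yx; rewrite mdistxx expr0n /= add0r => rx.
have z0 := mdist_ge0 x (g t).
have b0 := mdist_ge0 x y.
have a0 := mdist_ge0 y p.
move: (mdist x y) (mdist y p) (mdist x (g t)) => b a c in fz xz rz rx z0 b0 a0 *.
rewrite ler_pdivlMr; last by lra.
have c2 : c ^+ 2 <= (b + t * a) ^+ 2 by rewrite ler_sqr ?nnegrE //; nra.
have fz2 : 2 * tau * (f (g t) - f y) <=
  t * (2 * tau * (f p - f y) - K * tau * (1 - t) * a ^+ 2) by nra.
(* The comparison of [y] with [g t], divided by [t]. *)
have s1 : 2 * tau * (f y - f p) + K * tau * (1 - t) * a ^+ 2 <= 2 * a * b + t * a ^+ 2.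
  rewrite -(ler_pM2l t0); nra.
(* this choice of [t] makes the coefficient of [a ^+ 2] equal to [K tau - 1] *)
have s2 : 2 * tau * (f y - f p) + (K * tau - 1) * a ^+ 2 <= 2 * a * b.
  have -> : K * tau - 1 = K * tau * (1 - t) - t by lra.
  by lra.
(* Completing the square eliminates [a], the distance from [y] to [p]. *)
have s3 : 2 * tau * (f y - f p) * (K * tau - 1) <= b ^+ 2.
  have := sqr_ge0 (b - (K * tau - 1) * a).
  have kt : 0 < K * tau - 1 by lra.
  rewrite -(ler_pM2l kt) in s2; nra.
(* Minimality of [y] against [x] itself bounds [b ^ 2] by [2 * tau * (f x - f y)]. *)
have s4 : (f y - f p) * (K * tau - 1) <= f x - f y.
  by rewrite -(ler_pM2l tau0); lra.
by lra.
Qed.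

(** By the value bound, [f] drops from [x] to [y] by at least the fraction [1 - 1 / (K * tau)] of
    [f x - f p]; the Lipschitz condition turns this drop into distance. *)
Lemma resolvent_mdist_ge (K L tau : R) f p x y :
  0 < K -> 0 < L -> weakly_convex K f -> metric_lipschitz L f ->
  minimizers f p -> K^-1 < tau -> resolvent f tau x y ->
  (1 - 1 / (K * tau)) * ((f x - f p) / L) <= mdist x y.
Proof.
move=> K0 L0 fK fL fp tauK yx.
have := resolvent_value_le K0 fK fp tauK yx.
have := ler_norm (f x - f y); have := fL x y => h1 h2 h3.
by rewrite mulrA ler_pdivrMr // div1r; lra.
Qed.

(** * Comparison of two resolvent points *)

(** Seen from [p], neighbours in the chain [y1], [x1], [x2], [y2] have Gromov product at least
    [m - 2 * delta], because each resolvent point is almost between [p] and its source. Joining the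
    chain costs [delta] twice. *)
Lemma resolvent_gromov_ge (delta K tau m : R) f p x1 x2 y1 y2 :
  0 <= delta -> hyperbolic delta X -> 0 <= K -> weakly_convex K f ->
  minimizers f p -> 0 < tau -> resolvent f tau x1 y1 -> resolvent f tau x2 y2 ->
  m <= gromov p x1 x2 -> m <= mdist p y1 -> m <= mdist p y2 ->
  m - 4 * delta <= gromov p y1 y2.
Proof.
move=> d0 hyp K0 fK fp tau0 yx1 yx2 mG m1 m2.
have h1 := resolvent_almost_geodesic d0 hyp K0 fK fp tau0 yx1.
have h2 := resolvent_almost_geodesic d0 hyp K0 fK fp tau0 yx2.
have g1 : m - 2 * delta <= gromov p y1 x1.
  by rewrite /gromov (metric_sym y1 x1); lra.
have g2 : m - 3 * delta <= gromov p x2 y2 by rewrite /gromov; lra.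
have g12 : m - 2 * delta <= gromov p x1 x2 by lra.
have := hyperbolic_le hyp g1 g12 => g.
have {}g : m - 3 * delta <= gromov p y1 x2 by lra.
by have := hyperbolic_le hyp g g2; lra.
Qed.

(** With [m] equal to [gromov p x1 x2], unfolding the products doubles the loss to [8 * delta]; the
    two almost geodesics add [4 * delta] each. *)
Lemma resolvent_far (delta K tau : R) f p x1 x2 y1 y2 :
  0 <= delta -> hyperbolic delta X -> 0 <= K -> weakly_convex K f ->
  minimizers f p -> 0 < tau -> resolvent f tau x1 y1 -> resolvent f tau x2 y2 ->
  mdist p y1 <= mdist p y2 -> gromov p x1 x2 <= mdist p y1 ->
  mdist y1 y2 <= mdist x1 x2 - mdist x1 y1 - mdist x2 y2 + 16 * delta.
Proof.
move=> d0 hyp K0 fK fp tau0 yx1 yx2 y12 G1.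
have h1 := resolvent_almost_geodesic d0 hyp K0 fK fp tau0 yx1.
have h2 := resolvent_almost_geodesic d0 hyp K0 fK fp tau0 yx2.
have := resolvent_gromov_ge d0 hyp K0 fK fp tau0 yx1 yx2 (lexx _) G1 (le_trans G1 y12).
by rewrite /gromov; lra.
Qed.

Lemma resolvent_step (delta K tau s : R) f x1 x2 y1 y2 :
  0 <= delta -> hyperbolic delta X -> 0 <= K -> weakly_convex K f ->
  0 < tau -> resolvent f tau x1 y1 -> resolvent f tau x2 y2 ->
  0 < s -> s <= mdist y1 y2 -> s <= gromov y1 x1 y2 ->
  s * (mdist x1 y1 - mdist x2 y2) <= 2 * delta * (mdist x1 y1 + delta) + s ^+ 2.
Proof.
move=> d0 hyp K0 fK tau0 yx1 yx2 s0 sl sG.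
have [g gg gf] := convex_geodesic_le y1 y2 K0 fK.
have l0 : 0 < mdist y1 y2 by lra.
set t := s / mdist y1 y2.
have tl : t * mdist y1 y2 = s by rewrite divfK // gt_eqF.
have t01 : 0 <= t <= 1.
  by rewrite divr_ge0 ?(ltW l0) ?(ltW s0) //= ler_pdivrMr // mul1r.
have t01' : 0 <= 1 - t <= 1 by lra.
have [y1u uy2] := geodesic_mdist gg t01.
have [_ vy2] := geodesic_mdist gg t01'.
rewrite opprB addrCA subrr addr0 tl in vy2; rewrite tl in y1u.
have fu := gf _ t01; have fv := gf _ t01'.
have ru := resolvent_sqr_le (g t) tau0 yx1.
have rv := resolvent_sqr_le (g (1 - t)) tau0 yx2.
have := @hyperbolic_mdist_le delta x1 y1 (g t) y2 hyp.
rewrite y1u uy2 => /(_ _ sG) xu.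
have {}xu := xu ltac:(lra).
have := metric_triangle x2 y2 (g (1 - t)); rewrite (metric_sym y2) vy2 => xv.
(* The parameters [t] and [1 - t] are symmetric, so the two convexity bounds add up to
   [f y1 + f y2]. *)
have fuv : 2 * tau * (f (g t) + f (g (1 - t)) - f y1 - f y2) <= 0.
  by rewrite pmulr_rle0; lra.
have u0 := mdist_ge0 x1 (g t); have v0 := mdist_ge0 x2 (g (1 - t)).
have xu2 : mdist x1 (g t) ^+ 2 <= (mdist x1 y1 - s + 2 * delta) ^+ 2.
  by rewrite ler_sqr ?nnegrE //; lra.
have xv2 : mdist x2 (g (1 - t)) ^+ 2 <= (mdist x2 y2 + s) ^+ 2.
  by rewrite ler_sqr ?nnegrE //; lra.
have := mulr_ge0 (ltW s0) d0.
rewrite sqrrD sqrrB in xu2; rewrite sqrrD in xv2; lra.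
Qed.

Lemma resolvent_near (delta K tau s : R) f p x1 x2 y1 y2 :
  0 <= delta -> hyperbolic delta X -> 0 <= K -> weakly_convex K f ->
  minimizers f p -> 0 < tau -> resolvent f tau x1 y1 -> resolvent f tau x2 y2 ->
  mdist p y1 <= mdist p y2 -> mdist p y1 < gromov p x1 x2 -> 0 < s ->
  mdist y1 y2 <= mdist x1 x2 - gromov x1 p x2
    + (2 * (delta / s) * (mdist p x1 + delta) + 2 * s + 12 * delta).
Proof.
move=> d0 hyp K0 fK fp tau0 yx1 yx2 y12 G1 s0.
(* Both sides are [gromov x2 p x1]. *)
have -> : mdist x1 x2 - gromov x1 p x2 = mdist p x2 - gromov p x1 x2.
  by rewrite /gromov (metric_sym x1 p); lra.
have h1 := resolvent_almost_geodesic d0 hyp K0 fK fp tau0 yx1.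
have h2 := resolvent_almost_geodesic d0 hyp K0 fK fp tau0 yx2.
have Gc1 : gromov p x1 x2 <= mdist p x1 by exact: gromov_le_mdist.
have Gc2 : gromov p x1 x2 <= mdist p x2 by rewrite gromovC gromov_le_mdist.
have k0 : 0 <= delta / s by rewrite divr_ge0 // ltW.
have c0 := mdist_ge0 p x1.
have e0 : 0 <= (delta / s) * (mdist p x1 + delta) by rewrite mulr_ge0 //; lra.
have [ls|sl] := ltP (mdist y1 y2) s; first by lra.
have t1 := metric_triangle p y1 x1; rewrite (metric_sym y1 x1) in t1.
have b2 := mdist_ge0 x2 y2.
(* If the product is below [s], the points are already close: the four-point inequality through [x2]
   bounds [gromov p x1 y2] from below, hence [mdist x1 y2] from above. The cases are whether or not
   [y2] is, up to [2 * delta], within [gromov p x1 x2] of [p]. *)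
have [sG|Gs] := lerP s (gromov y1 x1 y2); last first.
  have [aG|Ga] := lerP (mdist p y2 - 2 * delta) (gromov p x1 x2).
    have g2 : mdist p y2 - 2 * delta <= gromov p x2 y2 by rewrite /gromov; lra.
    have := hyperbolic_le hyp aG g2.
    by move: Gs G1 Gc2; rewrite /gromov (metric_sym y1 x1); lra.
  have g2 : gromov p x1 x2 <= gromov p x2 y2 by move: Ga; rewrite /gromov; lra.
  have := hyperbolic_le hyp (lexx _) g2.
  by move: Gs G1 Gc2; rewrite /gromov (metric_sym y1 x1); lra.
have step := resolvent_step d0 hyp K0 fK tau0 yx1 yx2 s0 sl sG.
(* Taking [m] to be [mdist p y1] shows that [y1] is almost between [p] and [y2]. *)
have yy := resolvent_gromov_ge d0 hyp K0 fK fp tau0 yx1 yx2 (ltW G1) (lexx _) y12.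
have {}yy : mdist y1 y2 <= mdist p y2 - mdist p y1 + 8 * delta.
  by move: yy; rewrite /gromov; lra.
(* Comparing [y1] with [p], where [f] is least, makes the error depend on [mdist p x1] only. *)
have bc : mdist x1 y1 <= mdist p x1.
  have := resolvent_sqr_le p tau0 yx1; rewrite (metric_sym x1 p) => r.
  rewrite -ler_sqr ?nnegrE ?mdist_ge0 //; apply: le_trans r _.
  by rewrite gerDl pmulr_rle0 ?subr_le0; [exact: fp | lra].
have {}step : mdist x1 y1 - mdist x2 y2 <=
    2 * (delta / s) * (mdist x1 y1 + delta) + s.
  rewrite -(ler_pM2l s0); apply: le_trans step _.
  have sk : s * (delta / s) = delta by rewrite mulrC divfK // gt_eqF.
  suff -> : s * (2 * (delta / s) * (mdist x1 y1 + delta) + s) =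
    2 * (s * (delta / s)) * (mdist x1 y1 + delta) + s ^+ 2 by rewrite sk.
  by ring.
have : 2 * (delta / s) * (mdist x1 y1 + delta) <=
       2 * (delta / s) * (mdist p x1 + delta).
  by rewrite ler_wpM2l //; lra.
by lra.
Qed.

End HyperbolicMetric.

(** The error of [resolvent_near] at [s = Num.sqrt delta], with [D] in place of [mdist p x1]. *)
Definition resolvent_error (R : realType) (D delta : R) : R :=
  2 * Num.sqrt delta * (D + delta) + 2 * Num.sqrt delta + 12 * delta.

Lemma resolvent_error_bigO (R : realType) (D delta : R) :
  0 <= D -> 0 <= delta <= 1 ->
  `|resolvent_error D delta| <= (2 * D + 16) * delta `^ (4^-1).
Proof.
move=> D0 /andP[d0 d1].
have r0 := sqrtr_ge0 delta.
have rE := sqr_sqrtr d0.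
have r1 : Num.sqrt delta <= 1 by rewrite -(sqrtr1 R) ler_wsqrtr.
have rp : Num.sqrt delta <= delta `^ 4^-1.
  move: d0; rewrite le_eqVlt => /predU1P[<-|d0].
    by rewrite sqrtr0 powR_ge0.
  rewrite -powR12_sqrt ?(ltW d0) //; apply: ger_powR; first by rewrite d0.
  by rewrite lef_pV2 ?posrE //; lra.
(* As [delta <= 1], the three summands are at most [2 * D + 2], [2] and [12] times
   [Num.sqrt delta]. *)
rewrite /resolvent_error ger0_norm; first by nra.
by rewrite !addr_ge0 ?mulr_ge0 ?addr_ge0.
Qed.

(** For [delta > 0] take [s = Num.sqrt delta]. For [delta = 0] this [s] is not positive, but the
    error reduces to [2 * s], and [s] may tend to 0. *)
Lemma le_resolvent_error (R : realType) (c D delta a b : R) :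
  0 <= delta -> c <= D ->
  (forall s, 0 < s -> a <= b + (2 * (delta / s) * (c + delta) + 2 * s + 12 * delta)) ->
  a <= b + resolvent_error D delta.
Proof.
rewrite le_eqVlt => /predU1P[<-|d0] cD h.
  rewrite /resolvent_error sqrtr0; apply/ler_addgt0Pr => e e0.
  have := h (e / 2); rewrite divr_gt0 // => /(_ isT).
  by rewrite !mul0r; lra.
have r0 : 0 < Num.sqrt delta by rewrite sqrtr_gt0.
have := h _ r0; rewrite /resolvent_error.
have -> : delta / Num.sqrt delta = Num.sqrt delta.
  by rewrite -{1}(sqr_sqrtr (ltW d0)) expr2 mulfK // gt_eqF.
by nra.
Qed.

Theorem theorem1p3 (R : realType) :
  exists C : R -> R -> R -> R -> R -> R,
    (forall K L D tau : R, 0 <= K -> 0 < L -> 0 <= D -> 0 < tau ->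
       exists A delta0 : R, [/\ 0 < A, 0 < delta0 &
         forall delta : R, 0 <= delta <= delta0 ->
           `|C K L D tau delta| <= A * delta `^ (4^-1)])
    /\
    (forall (delta : R) (X : metricType R) (K L : R) (f : X -> R) (p : X),
       0 <= delta ->
       proper_space X -> hyperbolic delta X -> geodesic_space X ->
       0 <= K -> 0 < L ->
       weakly_convex K f -> metric_lipschitz L f ->
       minimizers f p ->
       forall (x1 x2 : X) (tau : R) (y1 y2 : X),
         0 < tau ->
         resolvent f tau x1 y1 -> resolvent f tau x2 y2 ->
         mdist p y1 <= mdist p y2 ->
         (gromov p x1 x2 <= mdist p y1 ->
            mdist y1 y2 <= mdist x1 x2 - mdist x1 y1 - mdist x2 y2
              + 20 * Num.sqrt (2 * tau * L * delta) / Num.sqrt (K * tau + 1)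
              + 24 * delta
            /\
            (0 < K -> K^-1 < tau ->
               mdist y1 y2 <= mdist x1 x2
                 - (1 - 1 / (K * tau)) * ((f x1 + f x2 - 2 * f p) / L)
                 + 20 * Num.sqrt (2 * tau * L * delta) / Num.sqrt (K * tau + 1)
                 + 24 * delta))
         /\
         (mdist p y1 < gromov p x1 x2 ->
            mdist y1 y2 <= mdist x1 x2 - gromov x1 p x2
              + C K L (Num.max (mdist p x1) (mdist p x2)) tau delta)).
Proof.
exists (fun _ _ D _ delta => resolvent_error D delta); split.
  move=> K L D tau _ _ D0 _; exists (2 * D + 16), 1; split => //; first lra.
  by move=> delta; exact: resolvent_error_bigO.
move=> delta X K L f p d0 _ hyp _ K0 L0 fK fL fp x1 x2 tau y1 y2 tau0 yx1 yx2 y12.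
split=> [G1|G1].
  have far := resolvent_far d0 hyp K0 fK fp tau0 yx1 yx2 y12 G1.
  (* The error [16 * delta] of [far] is below the stated one once the square-root term is known to
     be nonnegative. *)
  have : 0 <= 20 * Num.sqrt (2 * tau * L * delta) / Num.sqrt (K * tau + 1).
    by rewrite divr_ge0 ?mulr_ge0 ?sqrtr_ge0.
  split=> [|Kp tauK]; first by lra.
  have b1 := resolvent_mdist_ge Kp L0 fK fL fp tauK yx1.
  have b2 := resolvent_mdist_ge Kp L0 fK fL fp tauK yx2.
  have -> : f x1 + f x2 - 2 * f p = (f x1 - f p) + (f x2 - f p) by lra.
  by rewrite (mulrDl _ _ L^-1) mulrDr; lra.
apply: (@le_resolvent_error _ (mdist p x1)) => //; first by rewrite le_max lexx.
by move=> s; exact: resolvent_near d0 hyp K0 fK fp tau0 yx1 yx2 y12 G1.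
Qed.
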